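(* Let $E$ be a symmetric space on $I=[0,\infty)$ (with the Fatou property). If there is a point $x\in E\setminus\{0\}$ which is a point of $K$-order continuity of $E$, then $E$ is not embedded in $L^1[0,\infty)$, i.e. there is no constant $C>0$ such that every $y\in E$ belongs to $L^1[0,\infty)$ with $\|y\|_{L^1}\le C\|y\|_E$.
   Context: Let $\mu$ be Lebesgue measure on $I=[0,\infty)$ and let $L^0$ be the set of (equivalence classes of) extended real valued Lebesgue measurable functions on $I$. A Banach function space $E$ is a Banach lattice $(E,\|\cdot\|_E)$ which is a sublattice of $L^0$ such that: (1) if $x\in L^0$, $y\in E$ and $|x|\le|y|$ a.e., then $x\in E$ and $\|x\|_E\le\|y\|_E$; (2) there exists a strictly positive $x\in E$. $E^+=\{x\in E: x\ge 0\}$. $E$ has the Fatou property if whenever $(x_n)\subset E^+$, $\sup_n\|x_n\|_E<\infty$ and $x_n\uparrow x\in L^0$, then $x\in E$ and $\|x_n\|_E\uparrow\|x\|_E$. Standing assumption: $E$ has the Fatou property. For $x\in L^0$: the distribution function is $d_x(\lambda)=\mu\{s\in I:|x(s)|>\lambda\}$, $\lambda\ge0$; the decreasing rearrangement is $x^*(t)=\inf\{\lambda>0:d_x(\lambda)\le t\}$, $t\ge0$; the maximal function is $x^{**}(t)=\frac1t\int_0^t x^*(s)\,ds$, $t>0$. A Banach function space $E$ is symmetric if whenever $x\in L^0$, $y\in E$ and $d_x=d_y$, then $x\in E$ and $\|x\|_E=\|y\|_E$. For $x,y\in L^1+L^\infty$, $x\prec y$ iff $x^{**}(t)\le y^{**}(t)$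 for all $t>0$. $x\in E$ is a point of $K$-order continuity of $E$ if for every sequence $(x_n)\subset E$ with $x_n\prec x$ for all $n$ and $x_n^*\to0$ a.e. we have $\|x_n\|_E\to0$. *)

(* Defs.v *)
From HB Require Import structures.
From mathcomp Require Import all_boot all_order all_algebra.
From mathcomp Require Import all_classical all_reals all_analysis.
From mathcomp Require Import measurable_realfun.

Set Implicit Arguments.
Unset Strict Implicit.
Unset Printing Implicit Defensive.

Import Order.TTheory GRing.Theory Num.Theory.
Import numFieldNormedType.Exports.

Local Open Scope classical_set_scope.
Local Open Scope ring_scope.

(* An element of L^0[0,oo) is handled through its representatives: functions
   R -> \bar R that are measurable on [0,oo), two of them being identified when
   they agree a.e. on [0,oo); their values on negative reals are irrelevant.
   [measurable_fun] on R refers to the Borel sigma-algebra.  Every Lebesgue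
   measurable function is a.e. equal to a Borel one, so the classes are the same
   as those of the Lebesgue measurable functions. *)

Definition half_line (R : realType) : set R := `[0, +oo[%classic.
Arguments half_line : clear implicits.

Definition aeI (R : realType) (P : R -> Prop) : Prop :=
  {ae (@lebesgue_measure R), forall t, half_line R t -> P t}.

Definition inL0 (R : realType) (x : R -> \bar R) : Prop :=
  measurable_fun (half_line R) x.

(* [norm] is only meaningful on [E]. That [E] and [norm] depend only on a.e.
   classes follows from [bfs_ideal].  By [bfs_ideal] and [bfs_normZ] the elements
   of [E] are a.e. finite, so the conventions for oo - oo in the pointwise sums
   and differences of extended reals only matter on null sets. *)
Record banach_function_space (R : realType)
    (E : set (R -> \bar R)) (norm : (R -> \bar R) -> R) : Prop := {
  bfs_L0 : forall x, E x -> inL0 x;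
  bfs_zero : E (fun=> 0%E);
  bfs_add : forall x y, E x -> E y -> E (fun t => x t + y t)%E;
  bfs_scale : forall (a : R) x, E x -> E (fun t => a%:E * x t)%E;
  bfs_max : forall x y, E x -> E y -> E (fun t => maxe (x t) (y t));
  bfs_min : forall x y, E x -> E y -> E (fun t => mine (x t) (y t));
  bfs_norm_ge0 : forall x, E x -> 0 <= norm x;
  bfs_norm_eq0 : forall x, E x -> (norm x = 0 <-> aeI (fun t => x t = 0%E));
  bfs_normZ : forall (a : R) x, E x ->
    norm (fun t => a%:E * x t)%E = `|a| * norm x;
  bfs_normD : forall x y, E x -> E y ->
    norm (fun t => x t + y t)%E <= norm x + norm y;
  bfs_complete : forall u : nat -> R -> \bar R, (forall n, E (u n)) ->
    (forall e : R, 0 < e -> exists n0 : nat, forall m n : nat,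
       (n0 <= m)%N -> (n0 <= n)%N -> norm (fun t => u m t - u n t)%E < e) ->
    exists2 x, E x & norm (fun t => u n t - x t)%E @[n --> \oo] --> (0 : R);
  bfs_ideal : forall x y, inL0 x -> E y ->
    aeI (fun t => `|x t| <= `|y t|)%E -> E x /\ norm x <= norm y;
  bfs_weak_unit : exists2 x, E x & aeI (fun t => 0 < x t)%E
}.

Definition fatou_property (R : realType)
    (E : set (R -> \bar R)) (norm : (R -> \bar R) -> R) : Prop :=
  forall (u : nat -> R -> \bar R) (x : R -> \bar R),
    (forall n, E (u n) /\ aeI (fun t => 0 <= u n t)%E) ->
    (exists M : R, forall n, norm (u n) <= M) ->
    inL0 x ->
    (forall n, aeI (fun t => u n t <= u n.+1 t)%E) ->
    aeI (fun t => u n t @[n --> \oo] --> x t) ->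
    [/\ E x, (forall n, norm (u n) <= norm (u n.+1))
      & norm (u n) @[n --> \oo] --> norm x].

Definition distribution_function (R : realType) (x : R -> \bar R) (l : R) : \bar R :=
  @lebesgue_measure R (half_line R `&` [set s | l%:E < `|x s|]%E).

Definition rearrangement (R : realType) (x : R -> \bar R) (t : R) : \bar R :=
  ereal_inf [set l%:E | l in [set l : R | 0 < l /\ (distribution_function x l <= t%:E)%E]].

Definition maximal_function (R : realType) (x : R -> \bar R) (t : R) : \bar R :=
  ((t^-1)%:E * \int[@lebesgue_measure R]_(s in `[0%R, t]) rearrangement x s)%E.

Definition submajorized (R : realType) (x y : R -> \bar R) : Prop :=
  forall t : R, 0 < t -> (maximal_function x t <= maximal_function y t)%E.

Definition symmetric_space (R : realType)
    (E : set (R -> \bar R)) (norm : (R -> \bar R) -> R) : Prop :=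
  banach_function_space E norm /\
  forall x y, inL0 x -> E y ->
    (forall l : R, 0 <= l -> distribution_function x l = distribution_function y l) ->
    E x /\ norm x = norm y.

Definition K_order_continuity_point (R : realType)
    (E : set (R -> \bar R)) (norm : (R -> \bar R) -> R) (x : R -> \bar R) : Prop :=
  E x /\
  forall u : nat -> R -> \bar R, (forall n, E (u n)) ->
    (forall n, submajorized (u n) x) ->
    aeI (fun t => rearrangement (u n) t @[n --> \oo] --> 0%E) ->
    norm (u n) @[n --> \oo] --> (0 : R).

Definition embedded_in_L1 (R : realType)
    (E : set (R -> \bar R)) (norm : (R -> \bar R) -> R) : Prop :=
  exists2 C : R, 0 < C & forall y, E y ->
    (@lebesgue_measure R).-integrable (half_line R) y /\
    (\int[@lebesgue_measure R]_(t in half_line R) `|y t| <= (C * norm y)%:E)%E.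

(* Main.v *)
Require Import Defs.
From mathcomp Require Import all_boot all_order all_algebra.
From mathcomp Require Import all_classical all_reals all_analysis.
From mathcomp Require Import measurable_realfun.

Set Implicit Arguments.
Unset Strict Implicit.
Unset Printing Implicit Defensive.

Import Order.TTheory GRing.Theory Num.Theory.
Import numFieldNormedType.Exports.

Local Open Scope classical_set_scope.
Local Open Scope ring_scope.

(** If [x <> 0], then [|x| > l > 0] on a set of finite measure [T > 0], so that
    [x^*] dominates [l] times the indicator of [0 <= t < T]. The functions
    [u n := l / (n + 1) 1_{0 <= t < (n + 1) T}] have constant norm [l T] in [L^1], they are
    submajorized by [x], and [(u n)^*] tends to [0]. By symmetry they lie in [E],
    and [K]-order continuity at [x] forces their norms in [E] to tend to [0]. *)

(* Unlike [ge0_le_integral], this spares the measurability of rearrangements. *)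
Lemma ge0_le_integral_nomeas d (T : measurableType d) (R : realType)
    (mu : {measure set T -> \bar R}) (D : set T) (f g : T -> \bar R) :
  (forall t, D t -> (0 <= f t)%E) -> (forall t, D t -> (f t <= g t)%E) ->
  (\int[mu]_(t in D) f t <= \int[mu]_(t in D) g t)%E.
Proof.
move=> f0 fg.
rewrite !ge0_integralE//; last by move=> t Dt; exact: le_trans (f0 t Dt) (fg t Dt).
apply: le_ereal_sup => _ [h hf <-]; exists h => // t.
apply: (le_trans (hf t)); rewrite /patch; case: ifPn => // tD.
by apply: fg; rewrite inE in tD.
Qed.

Section half_line_indicators.
Context {R : realType}.
Implicit Types (x : R -> \bar R) (c l t T : R) (A D : set R).
Local Notation mu := (@lebesgue_measure R).

Lemma measurable_half_line : measurable (half_line R).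
Proof. exact: measurable_itv. Qed.

Lemma inL0_cst_indic c A : measurable A -> inL0 (fun t => (c * \1_A t)%:E).
Proof.
by move=> mA; apply/measurable_EFinP; exact: measurable_funM.
Qed.

Lemma distribution_function_cst_indic c A l :
  A `<=` half_line R -> 0 < c -> 0 <= l ->
  distribution_function (fun t => (c * \1_A t)%:E) l =
  if l < c then mu A else 0%E.
Proof.
move=> AI c0 l0; rewrite /distribution_function; case: ifPn => lc.
  congr (mu _); apply/seteqP; split => t /=.
    move=> [_]; rewrite indicE; case: (boolP (t \in A)) => [/[!inE]//|_].
    by rewrite mulr0 normr0 lte_fin ltNge l0.
  move=> At; split; first exact: AI.
  by rewrite indicE mem_set// mulr1 lte_fin gtr0_norm.
rewrite -(measure0 mu); congr (mu _); rewrite -subset0 => t [_ /=].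
rewrite lte_fin indicE; case: (t \in A).
  by rewrite mulr1 gtr0_norm// (negbTE lc).
by rewrite mulr0 normr0 ltNge l0.
Qed.

Lemma distribution_function_le x l l' : inL0 x -> l' <= l ->
  (distribution_function x l <= distribution_function x l')%E.
Proof.
move=> mx ll'.
have mabs k : measurable (half_line R `&` [set s | k%:E < `|x s|]%E).
  apply: emeasurable_fun_o_infty; first exact: measurable_half_line.
  exact: measurableT_comp.
apply: le_measure; rewrite ?inE; [exact: mabs|exact: mabs|].
move=> s [Is /= ls]; split => //=; apply: le_lt_trans ls.
by rewrite lee_fin.
Qed.

Lemma itv0_measure T : 0 <= T -> mu `[0, T[ = T%:E.
Proof.
move=> T0; rewrite lebesgue_measure_itv/= lte_fin oppr0 adde0; case: ltP => // ?.
by congr EFin; apply/le_anti; rewrite T0.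
Qed.

Lemma itv0_half_line T : `[0, T[ `<=` half_line R.
Proof. by move=> t; rewrite /half_line/= !in_itv/= => /andP[->]. Qed.

Lemma rearrangement_ge0 x t : (0 <= rearrangement x t)%E.
Proof. by apply: le_ereal_inf_tmp => _ [l [l0 _] <-]; rewrite lee_fin ltW. Qed.

Lemma rearrangement_cst_indic_le c T t : 0 < c -> 0 <= T -> 0 <= t ->
  (rearrangement (fun s => (c * \1_(`[0%R, T[) s)%:E) t <= (c * \1_(`[0%R, T[) t)%:E)%E.
Proof.
move=> c0 T0 t0; rewrite indicE; case: (boolP (t \in _)) => [_|].
  (* The level [c] itself is admissible: the function never exceeds it, so its distribution function
     vanishes there. *)
  rewrite mulr1; apply: ereal_inf_lbound; exists c => //; split => //.
  rewrite distribution_function_cst_indic ?ltxx ?lee_fin ?(ltW c0)//.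
  exact: itv0_half_line.
rewrite mulr0 notin_setE/= in_itv/= t0/= => /negP; rewrite -leNgt => Tt.
(* The infimum runs over strictly positive levels only, so 0 is reached through arbitrary [e > 0];
   each is admissible because the support has measure [T <= t]. *)
apply/lee_addgt0Pr => e e0; rewrite add0e.
apply: ereal_inf_lbound; exists e => //; split => //.
rewrite distribution_function_cst_indic ?(ltW e0)//; last exact: itv0_half_line.
by case: ifPn => _; rewrite ?itv0_measure ?lee_fin.
Qed.

(** A level [k < l] admissible at some [t < T] would give [T <= d_x(l) <= d_x(k) <= t]. *)
Lemma rearrangement_ge_cst_indic x l T t :
  inL0 x -> 0 <= l -> (T%:E <= distribution_function x l)%E ->
  ((l * \1_(`[0%R, T[) t)%:E <= rearrangement x t)%E.
Proof.
move=> mx l0 Tx; rewrite indicE; case: (boolP (t \in _)) => [|_]; last first.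
  by rewrite mulr0 rearrangement_ge0.
rewrite inE/= in_itv/= => /andP[t0 tT]; rewrite mulr1.
apply: le_ereal_inf_tmp => _ [k [k0 kt] <-]; rewrite lee_fin leNgt; apply/negP => kl.
have := le_trans Tx (le_trans (distribution_function_le mx (ltW kl)) kt).
by rewrite lee_fin leNgt tT.
Qed.

Lemma integral_cst_indic c A D : measurable A -> measurable D -> 0 <= c ->
  (\int[mu]_(s in D) (c * \1_A s)%:E = c%:E * mu (A `&` D))%E.
Proof.
move=> mA mD c0; under eq_integral do rewrite EFinM.
rewrite ge0_integralZl_EFin ?integral_indic//.
by apply/measurable_EFinP; exact: measurable_indic.
Qed.

Lemma integral_cst_indic_itv0 c T t : 0 <= c -> 0 <= T -> 0 <= t ->
  (\int[mu]_(s in `[0%R, t]) (c * \1_(`[0%R, T[) s)%:E)%E = (c * Num.min T t)%:E.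
Proof.
move=> c0 T0 t0.
rewrite integral_cst_indic// EFinM; congr (_ * _)%E.
case: leP => [Tt|tT].
  rewrite setIidl ?itv0_measure// => s /=; rewrite !in_itv/= => /andP[-> sT].
  exact: ltW (lt_le_trans sT Tt).
rewrite setIidr => [|s /=]; last first.
  by rewrite !in_itv/= => /andP[-> st]; exact: le_lt_trans tT.
rewrite lebesgue_measure_itv/= lte_fin oppr0 adde0; case: ltP => // ?.
by congr EFin; apply/le_anti; rewrite t0.
Qed.

(** Over [[0, t]] the spread function has a rearrangement of integral at most [l / (n + 1) * min ((n
    + 1) T) t = l * min T (t / (n + 1))]. This is at most [l * min T t], the integral of [l] times
    the indicator of [[0, T[], which lies below [x^*]. *)
Lemma submajorized_spread x l T n : inL0 x -> 0 < l -> 0 <= T ->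
  (T%:E <= distribution_function x l)%E ->
  submajorized (fun s => (l / n.+1%:R * \1_(`[0%R, n.+1%:R * T[) s)%:E) x.
Proof.
move=> mx l0 T0 Tx t t0; have l0' : 0 < l / n.+1%:R by rewrite divr_gt0.
rewrite /maximal_function lee_wpmul2l// ?lee_fin ?invr_ge0 ?(ltW t0)//.
have nT0 : 0 <= n.+1%:R * T by rewrite mulr_ge0.
apply: (@le_trans _ _ (l / n.+1%:R * Num.min (n.+1%:R * T) t)%:E).
  rewrite -integral_cst_indic_itv0// ?(ltW t0) ?(ltW l0')//.
  apply: ge0_le_integral_nomeas => [s _|s]; first exact: rearrangement_ge0.
  by rewrite /= in_itv/= => /andP[s0 _]; exact: rearrangement_cst_indic_le.
apply: (@le_trans _ _ (l * Num.min T t)%:E).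
  rewrite lee_fin -mulrA ler_wpM2l ?(ltW l0)// minr_pMr ?invr_ge0//.
  rewrite mulKf// le_min !ge_min lexx/=; apply/orP; right.
  by rewrite ler_piMl ?(ltW t0)// invf_le1// ler1n.
rewrite -integral_cst_indic_itv0// ?(ltW t0) ?(ltW l0)//.
apply: ge0_le_integral_nomeas => s _.
  by rewrite lee_fin mulr_ge0 ?(ltW l0)// indicE.
by apply: rearrangement_ge_cst_indic; rewrite ?(ltW l0).
Qed.

(** The sets [F n] exhaust the part of the half-line where [x] is nonzero, so one of them is not
    null. Cutting with [[0, n]] keeps its measure finite, as a real [T] requires, since a whole
    level set may have infinite measure. *)
Lemma nonzero_level_set x : inL0 x -> ~ aeI (fun t => x t = 0%E) ->
  exists l T A, [/\ 0 < l, 0 < T, measurable A, mu A = T%:E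
    & A `<=` half_line R `&` [set s | l%:E < `|x s|]%E].
Proof.
move=> mx xN0; apply: contrapT => noA; apply: xN0.
pose F n : set R := `[0%R, n%:R] `&`
  (half_line R `&` [set s | (n.+1%:R^-1)%:E < `|x s|]%E).
have mF n : measurable (F n).
  apply: measurableI => //; apply: emeasurable_fun_o_infty.
    exact: measurable_half_line.
  exact: measurableT_comp.
have F0 n : mu (F n) = 0%E.
  apply: contra_notP noA => /eqP Fn0.
  have Ffin : mu (F n) \is a fin_num.
    rewrite ge0_fin_numE//; apply: (@le_lt_trans _ _ (mu `[0%R, n%:R])).
      by apply: le_measure; rewrite ?inE//; [exact: mF|exact: subIsetl].
    by rewrite lebesgue_measure_itv/=; case: ifP; rewrite ?ltry// oppr0 adde0 ltry.
  exists n.+1%:R^-1, (fine (mu (F n))), (F n); split => //.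
  - by rewrite -lte_fin fineK// lt_neqAle eq_sym Fn0 measure_ge0.
  - by rewrite fineK.
  - exact: subIsetr.
apply: (@negligibleS _ _ _ mu (\bigcup_n F n)); last first.
  by apply: negligible_bigcup => n; exists (F n); split; [exact: mF|exact: F0|].
move=> t /= /not_implyP[It /eqP xt0].
have [k xk] : exists k, ((k.+1%:R^-1)%:E < `|x t|)%E.
  have : (0 < `|x t|)%E by rewrite lt_neqAle abse_ge0 eq_sym abse_eq0 xt0.
  case: (`|x t|)%E => [r||]; rewrite ?lte_fin => // r0.
    have [k] := ltr_add_invr r0; rewrite add0r => kr.
    by exists k; rewrite lte_fin.
  by exists 0%N; rewrite ltry.
(* One index serves both constraints: it exceeds [t], and its level is at most [1 / (k + 1)]. *)
exists (maxn k (Num.truncn t).+1) => //; split => /=.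
  move: It; rewrite /half_line/= !in_itv/= andbT => -> /=.
  apply: (ltW (lt_le_trans (truncnS_gt t) _)).
  by rewrite ler_nat leq_maxr.
split => //; apply: le_lt_trans xk.
by rewrite lee_fin lef_pV2 ?posrE// ler_nat ltnS leq_maxl.
Qed.

End half_line_indicators.

Theorem theorem4p4 (R : realType)
    (E : set (R -> \bar R)) (norm : (R -> \bar R) -> R) :
  symmetric_space E norm ->
  fatou_property E norm ->
  (exists x : R -> \bar R,
     ~ aeI (fun t => x t = 0%E) /\ K_order_continuity_point E norm x) ->
  ~ embedded_in_L1 E norm.
Proof.
move=> [bfsE symE] _ [x [xN0 [Ex Kx]]] [C C0 EL1].
have mx := bfs_L0 bfsE Ex.
have [l [T [A [l0 T0 mA muA Ax]]]] := nonzero_level_set mx xN0.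
have AI : A `<=` half_line R by move=> t /Ax[].
(* On [A] one has [1 <= |x / l|], so the ideal property applies. The factor 1 keeps the shape
   [c * \1_A] of the preceding lemmas. *)
have E1A : E (fun t => (1 * \1_A t)%:E).
  have Elx := bfs_scale bfsE l^-1 Ex.
  apply: (proj1 (bfs_ideal bfsE (inL0_cst_indic 1 mA) Elx _)).
  apply: aeW => t _; rewrite mul1r indicE; case: (boolP (t \in A)) => tA; last first.
    by rewrite abse0 abse_ge0.
  have [_ /= /ltW lx] := Ax _ (set_mem tA).
  rewrite abseM !abse_EFin normr1 gtr0_norm ?invr_gt0//.
  by rewrite lee_pdivlMl// mule1.
have EB B : measurable B -> B `<=` half_line R -> lebesgue_measure B = T%:E ->
    E (fun t => (1 * \1_B t)%:E).
  move=> mB BI muB; apply: (proj1 (symE _ _ (inL0_cst_indic 1 mB) E1A _)).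
  by move=> k k0; rewrite !distribution_function_cst_indic// muA muB.
(* The interval is assembled from [n] adjacent blocks of length [T]; each block is equimeasurable
   with [A], so symmetry puts its indicator in [E]. *)
have E1 n : E (fun t => (1 * \1_(`[0%R, n%:R * T[) t)%:E).
  elim: n => [|n IH].
    rewrite mul0r set_itvco0; under eq_fun do rewrite indic0 mulr0.
    exact: bfs_zero bfsE.
  have nT0 : 0 <= n%:R * T by rewrite mulr_ge0// ltW.
  have nTS : n%:R * T <= n.+1%:R * T by rewrite ler_wpM2r ?(ltW T0)// ler_nat.
  have ES : E (fun t => (1 * \1_(`[n%:R * T, n.+1%:R * T[) t)%:E).
    apply: EB => //.
    - move=> t; rewrite /half_line/= !in_itv/= andbT => /andP[+ _].
      exact: le_trans.
    - rewrite lebesgue_measure_itv/= lte_fin ltr_pM2r// ltr_nat ltnSn.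
      by rewrite -EFinB -mulrBl -natrB// subSnn mul1r.
  apply: (proj1 (bfs_ideal bfsE (inL0_cst_indic 1 _) (bfs_add bfsE IH ES) _)) => //.
  apply: aeW => t _; rewrite !indicE !mul1r -EFinD !abse_EFin lee_fin.
  rewrite !mem_setE !in_itv/=.
  case: (ltP t (n%:R * T)) => [tn|tn].
    by rewrite (lt_le_trans tn nTS) andbT /= addr0.
  by rewrite andbF /= add0r (le_trans nT0 tn).
pose u n t := (l / n.+1%:R * \1_(`[0%R, n.+1%:R * T[) t)%:E.
have Eu n : E (u n).
  have := bfs_scale bfsE (l / n.+1%:R) (E1 n.+1); congr E.
  by apply/funext => t; rewrite mul1r.
have Tx : (T%:E <= distribution_function x l)%E.
  rewrite -muA; apply: le_measure; rewrite ?inE//.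
  apply: emeasurable_fun_o_infty; first exact: measurable_half_line.
  exact: measurableT_comp.
(* The factors [n + 1] in height and length cancel in the integral, so the embedding bounds
   [norm (u n)] below uniformly in [n]. *)
have unorm n : l * T <= C * norm (u n).
  have [_] := EL1 _ (Eu n).
  rewrite -lee_fin; apply: le_trans.
  under eq_integral => t _.
    rewrite abse_EFin ger0_norm; last first.
      by rewrite mulr_ge0 ?divr_ge0 ?(ltW l0)// indicE.
    over.
  rewrite integral_cst_indic ?divr_ge0 ?(ltW l0)//; last exact: measurable_half_line.
  rewrite setIidl; last exact: itv0_half_line.
  rewrite itv0_measure ?mulr_ge0 ?(ltW T0)// -EFinM lee_fin.
  by rewrite mulrA divfK.
have cv0 : l / n.+1%:R @[n --> \oo] --> (0 : R).
  by rewrite -[0](mulr0 l); apply: cvgMr; exact: cvg_harmonic.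
have : norm (u n) @[n --> \oo] --> (0 : R).
  apply: Kx => //.
    by move=> n; apply: submajorized_spread => //; exact: ltW.
  apply: aeW => t; rewrite /half_line/= in_itv/= andbT => t0.
  (* At every [t >= 0] the rearrangement is at most the height [l / (n + 1)] of [u n]. *)
  apply: (@squeeze_cvge _ _ _ _ (cst 0%E) _ (fun n => (l / n.+1%:R)%:E)).
  - apply: nearW => n; rewrite rearrangement_ge0 /=.
    apply: le_trans (rearrangement_cst_indic_le _ _ t0) _.
    + by rewrite divr_gt0.
    + by rewrite mulr_ge0 ?(ltW T0).
    + by rewrite lee_fin ler_piMr ?divr_ge0 ?(ltW l0)// indicE lern1 leq_b1.
  - exact: cvg_cst.
  - by apply: cvg_comp cv0 _.
(* The uniform lower bound passes to the limit, which is 0, whereas [l * T / C > 0]. *)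
move=> un0; have : l * T / C <= lim (norm (u n) @[n --> \oo]).
  apply: limr_ge; first by apply/cvg_ex; exists 0.
  by apply: nearW => n; rewrite ler_pdivrMr// (mulrC _ C); exact: unorm.
rewrite (cvg_lim _ un0)// leNgt => /negP; apply.
by rewrite divr_gt0// mulr_gt0.
Qed.
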